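(* Let $A\in\mathcal{M}_n(\mathbb{R})$ have characteristic polynomial $\chi_A$, and let $A=S+N$ be its generalized Dunford decomposition. Let $P=\dfrac{\chi_A}{\gcd(\chi_A,\chi_A')}$, normalized to be monic, and write $P(X)=X^r+\sum_{k=0}^{r-1}a_kX^k$. Let $M=1+\max_{0\le i\le r-1}|a_i|$. For $x\in\mathbb{R}$ let $V(x)$ be the number of sign changes at $x$ of the Sturm sequence of $P$. Then $$V(-M)-V(M)=r\iff S\text{ is diagonalizable over }\mathbb{R}.$$
   Context: Here $n\ge 1$ and $\chi_A=\det(A-XI_n)$. Generalized Dunford decomposition: for $A\in\mathcal{M}_n(\mathbb{R})$, $(S,N)$ is the unique pair of real $n\times n$ matrices with $A=S+N$, $SN=NS$, $N$ nilpotent and $S$ semi-simple. A real matrix is semi-simple if every subspace of $\mathbb{R}^n$ stable under it has a complementary subspace stable under it. Sturm sequence of $P\in\mathbb{R}[X]$: $S_0=P$, $S_1=P'$ and, for $i\ge 1$ as long as $S_i\ne 0$, $S_{i+1}$ is the opposite of the remainder of the Euclidean division of $S_{i-1}$ by $S_i$ (so $S_{i-1}=Q_iS_i-S_{i+1}$ for some polynomial $Q_i$, with $\deg S_{i+1}<\deg S_i$). Let $p$ be the index with $S_p\ne 0$ and $S_{p+1}=0$. Number of sign changes: $V(x)$ is the number of pairs $(i,j)$ with $0\le i<j\le p$, $S_i(x)S_j(x)<0$, and $S_k(x)=0$ for all integers $k$ with $i<k<j$; that is, the number of sign changes in the list $S_0(x),\dots,S_p(x)$ after discarding zeros. *)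

(* Defs.v *)
From mathcomp Require Import all_boot all_order all_algebra.
From mathcomp Require Import reals.

Set Implicit Arguments.
Unset Strict Implicit.
Unset Printing Implicit Defensive.

Import Order.TTheory GRing.Theory Num.Theory.
Local Open Scope ring_scope.

(* det (A - X I_n), which differs from MathComp's [char_poly A] by (-1)^n. *)
Definition charpoly (R : realType) (n : nat) (A : 'M[R]_n) : {poly R} :=
  \det (map_mx polyC A - 'X%:M).

(* Matrices act here on column vectors, unlike in [stablemx]. *)
Definition stable_subspace (R : realType) (n : nat) (A : 'M[R]_n)
    (U : {vspace 'cV[R]_n}) : Prop :=
  forall v : 'cV[R]_n, v \in U -> A *m v \in U.

Definition semisimple_mx (R : realType) (n : nat) (A : 'M[R]_n) : Prop :=
  forall U : {vspace 'cV[R]_n}, stable_subspace A U ->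
  exists W : {vspace 'cV[R]_n},
    [/\ stable_subspace A W, (U + W = fullv)%VS & (U :&: W = 0)%VS].

Definition nilpotent_mx (R : realType) (n : nat) (N : 'M[R]_n) : Prop :=
  exists k : nat, N ^+ k = 0.

Definition dunford_decomposition (R : realType) (n : nat)
    (A S N : 'M[R]_n) : Prop :=
  [/\ A = S + N, S *m N = N *m S, nilpotent_mx N & semisimple_mx S].

Definition monic_normalization (R : realType) (p : {poly R}) : {poly R} :=
  (lead_coef p)^-1 *: p.

(* [gcdp] is only determined up to a nonzero constant factor, which the
   normalization removes. *)
Definition reduced_charpoly (R : realType) (n : nat) (A : 'M[R]_n) :
    {poly R} :=
  let chi := charpoly A in
  monic_normalization (chi %/ gcdp chi chi^`()).

(* 1 + the maximum of the |p_i| for i < deg p. The seed 0 of the maximum is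
   harmless: absolute values are nonnegative. *)
Definition root_bound (R : realType) (p : {poly R}) : R :=
  1 + \big[Num.max/0]_(i < (size p).-1) `|p`_i|.

Fixpoint sturm_from (R : realType) (fuel : nat) (p q : {poly R}) :
    seq {poly R} :=
  p :: (if fuel is fuel'.+1 then
          if q == 0 then [::] else sturm_from fuel' q (- (p %% q))
        else [::]).

(* The sequence is cut at its last nonzero term; the fuel [size p] is enough
   because degrees decrease, see [sturmP]. *)
Definition sturm (R : realType) (p : {poly R}) : seq {poly R} :=
  sturm_from (size p) p p^`().

Lemma sturm_fromP (R : realType) (fuel : nat) (p q : {poly R}) :
    p != 0 -> (size q <= fuel)%N ->
  let s := sturm_from fuel p q in
  [/\ s`_0 = p, s`_1 = q,
      forall i : nat, (i.+1 < size s)%N -> s`_i.+2 = - (s`_i %% s`_i.+1)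
    & all (fun f => f != 0) s].
Proof.
elim: fuel p q => [|fuel IHf] p q p0 /=.
  by rewrite leqn0 size_poly_eq0 => /eqP ->; rewrite p0.
case: eqVneq => [-> _|q0 szq] /=; first by rewrite p0.
have szr : (size (- (p %% q))%R <= fuel)%N.
  by rewrite size_polyN -ltnS (leq_trans _ szq) // ltn_modp.
have /= [s0 s1 sE sn0] := IHf _ _ q0 szr.
by rewrite p0 sn0; split=> // -[|i]; rewrite /= ?s0 ?s1 // ltnS => /sE.
Qed.

(* Terms beyond the end of the list read as 0: the third item, at the
   last index, says that the last term divides the previous one. *)
Lemma sturmP (R : realType) (p : {poly R}) : p != 0 ->
  let s := sturm p in
  [/\ s`_0 = p, s`_1 = p^`(),
      forall i : nat, (i.+1 < size s)%N -> s`_i.+2 = - (s`_i %% s`_i.+1)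
    & all (fun f => f != 0) s].
Proof.
by move=> p0; apply: sturm_fromP => //; apply/ltnW/lt_size_deriv.
Qed.

Definition sign_changes (R : realType) (s : seq {poly R}) (x : R) : nat :=
  #|[set ij : 'I_(size s) * 'I_(size s) |
      [&& (ij.1 < ij.2)%N,
          (s`_(ij.1)).[x] * (s`_(ij.2)).[x] < 0
        & [forall k : 'I_(size s),
             (ij.1 < k < ij.2)%N ==> ((s`_k).[x] == 0)]]]|.

(* Main.v *)
Require Import Defs.
From mathcomp Require Import all_boot all_order all_algebra.
From mathcomp Require Import reals.
From mathcomp Require Import separable polyorder polyrcf qe_rcf_th.

Set Implicit Arguments.
Unset Strict Implicit.
Unset Printing Implicit Defensive.

Import Order.TTheory GRing.Theory Num.Theory.
Local Open Scope ring_scope.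

(** The proof has an analytic half and an algebraic half, which meet in the
    condition that P is a product of distinct linear factors over R.

    Analytic half. Sturm's theorem ([sturm_theorem]) says that, for a < b that
    are not roots of p, the difference V(a) - V(b) of the sign changes of the
    Sturm sequence of p is the number of distinct roots of p in ]a, b[. Its
    core is the inversion formula for Cauchy indices: one step of the Sturm
    sequence changes the Cauchy index of p'/p by exactly the change of sign of
    the two leading terms ([sturm_from_cindex]). That computation needs every
    term of the sequence to be nonzero at both ends; when an inner term
    vanishes at an end, its two neighbours have opposite signs there, so moving
    the end slightly does not alter V ([sign_changes_near]). Every real root of
    the monic polynomial P has absolute value < M ([lt_root_bound]), so
    V(-M) - V(M) counts all the real roots of P, and it equals r = deg P iff P
    splits with simple roots ([size_roots_split]).

    Algebraic half. P is squarefree, divides the characteristic polynomial chi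
    of A, and chi divides a power of P ([reduced_charpolyP]). Evaluating a
    polynomial at A or at S gives the same result up to nilpotents
    ([horner_mx_nilpotentD]), and a nilpotent polynomial in the semi-simple
    matrix S is zero ([semisimple_horner_nilpotent]). If P splits with simple
    roots, then P(A) is nilpotent by Cayley-Hamilton, hence P(S) is nilpotent,
    hence P(S) = 0, and S is diagonalizable. Conversely, if S is
    diagonalizable, some split q kills S, so q(A) is nilpotent and chi divides
    a power of q ([char_poly_dvd_expr]); the squarefree divisor P of chi is
    then a product of distinct linear factors ([separable_split]). *)

(** * Sign changes of a list of numbers *)

Definition nonzeros (R : rcfType) (s : seq R) : seq R := [seq a <- s | a != 0].

Lemma head_nonzeros (R : rcfType) (s : seq R) (j : nat) :
  s`_j != 0 -> (forall k, (k < j)%N -> s`_k = 0) -> head 0 (nonzeros s) = s`_j.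
Proof.
elim: s j => [|a s IHs] [|j] //=; rewrite ?eqxx //.
  by move=> ->.
move=> sj z; have /= -> := z 0%N isT; rewrite eqxx; apply: IHs => // k kj.
exact: (z k.+1).
Qed.

Lemma head_nonzeros_first (R : rcfType) (s : seq R) :
  head 0 (nonzeros s) != 0 ->
  exists2 j : 'I_(size s), head 0 (nonzeros s) = s`_j
    & forall k, (k < j)%N -> s`_k = 0.
Proof.
elim: s => [|a s IHs] /=; first by rewrite eqxx.
rewrite -/(nonzeros s).
case: (eqVneq a 0) => /= [a0 hs|a0 _]; last by exists ord0.
have [j -> jmin] := IHs hs.
by exists (lift ord0 j) => //= -[|k] //= /jmin.
Qed.

(** The pair count of [sign_changes], for a list of numbers instead of
    polynomials: it only depends on the values at the given point. *)
Definition zero_skipping_changes (R : rcfType) (s : seq R) : nat :=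
  #|[set ij : 'I_(size s) * 'I_(size s) |
      [&& (ij.1 < ij.2)%N, s`_(ij.1) * s`_(ij.2) < 0
        & [forall k : 'I_(size s),
             (ij.1 < k < ij.2)%N ==> (s`_k == 0)]]]|.

(** The pairs that start at the new first index 0 must end at the first nonzero
    item of [s], so there is at most one; the others are the shifts of the pairs
    of [s]. *)
Lemma zero_skipping_changes_cons (R : rcfType) (a : R) (s : seq R) :
  zero_skipping_changes (a :: s) =
    ((a * head 0 (nonzeros s) < 0)%R + zero_skipping_changes s)%N.
Proof.
rewrite /zero_skipping_changes /=; set X := [set ij | _].
pose first := [set ij in X | ij.1 == ord0].
rewrite -(cardsID first X); congr (_ + _)%N.
  have -> : X :&: first = first by apply/setIidPr/subsetP => ij /setIdP[].
  case: ltrP => [ah_lt0|ah_ge0] /=.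
    have h0 : head 0 (nonzeros s) != 0.
      by apply: contraTneq ah_lt0 => ->; rewrite mulr0 ltxx.
    have [j hj jmin] := head_nonzeros_first h0.
    rewrite -(cards1 (ord0 : 'I_(size s).+1, lift ord0 j)).
    apply: eq_card => -[i' j']; rewrite !inE /=.
    apply/idP/eqP => [/andP[/and3P[ij aj /forallP z] /eqP i0]|[-> ->]].
      rewrite {i'}i0 /= in ij aj z *; congr (_, _); apply/val_inj => /=.
      case: j' ij aj z => -[//|j'] /= ltj' _ aj' z; rewrite /bump add1n.
      case: (ltngtP j j') => // [jj'|j'j|-> //].
        have /= := z (lift ord0 j); rewrite /bump add1n ltnS jj' -hj /=.
        by rewrite (negPf h0).
      by move: aj'; rewrite jmin // mulr0 ltxx.
    rewrite /= -hj ah_lt0 andbT; apply/forallP => -[[|k] ltk] //=.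
    by apply/implyP => /jmin ->.
  apply/eqP; rewrite cards_eq0 -subset0; apply/subsetP => -[i' j'].
  rewrite !inE /= => /andP[/and3P[ij aj /forallP z] /eqP i0].
  rewrite {i'}i0 /= in ij aj z; case: j' ij aj z => -[//|j'] /= ltj' _ aj' z.
  have s0 : s`_j' != 0 by apply: contraTneq aj' => ->; rewrite mulr0 ltxx.
  move: ah_ge0; rewrite (head_nonzeros s0) ?leNgt ?aj' // => k kj.
  have ltk : (k.+1 < (size s).+1)%N by rewrite (ltn_trans _ ltj').
  by have /= := z (Ordinal ltk); rewrite ltnS kj => /eqP.
pose f (ij : 'I_(size s) * 'I_(size s)) := (lift ord0 ij.1, lift ord0 ij.2).
have f_inj : injective f.
  by move=> [i j] [i' j'] [] /val_inj -> /val_inj ->.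
rewrite -(card_imset _ f_inj); apply: eq_card => -[i j].
apply/idP/imsetP => [|[[i' j']]].
  rewrite !inE /= => /andP[ni /and3P[ij aj /forallP z]].
  rewrite ij aj /= in ni; move: ni; rewrite negb_and.
  have -> /= : [forall k : 'I_(size s).+1,
      (i < k < j)%N ==> ((a :: s)`_k == 0)].
    exact/forallP.
  case: (unliftP ord0 i) ij aj z => [i'|] ->; last by rewrite eqxx.
  case: (unliftP ord0 j) => [j'|] -> //= ij aj z _.
  exists (i', j') => //; rewrite inE /= -ltnS; apply/and3P; split=> //.
  by apply/forallP => k; apply: (z (lift ord0 k)).
rewrite !inE /= => /and3P[ij aj /forallP z] [-> ->] /=; rewrite ltnS ij aj /=.
rewrite andbF andTb; apply/forallP => k.
case: (unliftP ord0 k) => [k'|] -> //=; exact: z.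
Qed.

(** [changes] compares adjacent items only, hence the removal of the zeros. *)
Lemma zero_skipping_changesE (R : rcfType) (s : seq R) :
  zero_skipping_changes s = changes (nonzeros s).
Proof.
elim: s => [|a s IHs].
  by apply/eqP; rewrite cards_eq0 -subset0; apply/subsetP => -[[]].
rewrite zero_skipping_changes_cons IHs /=.
by case: (eqVneq a 0) => [->|a0] //=; rewrite mul0r ltxx.
Qed.

Lemma sign_changesE (R : realType) (s : seq {poly R}) (x : R) :
  sign_changes s x = changes (nonzeros [seq f.[x] | f <- s]).
Proof.
rewrite -zero_skipping_changesE /zero_skipping_changes /sign_changes.
rewrite size_map; apply: eq_card => -[i j]; rewrite !inE /=.
rewrite !(nth_map 0) //; congr [&& _, _ & _]; apply: eq_forallb => k.
by rewrite (nth_map 0).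
Qed.

(** Perturbing a list: an isolated zero between two items of opposite signs may
    be replaced by any nonzero number, since exactly one of the two adjacent
    pairs that it then forms is a sign change. *)
Lemma changes_isolated_zeros (R : rcfType) (u v : seq R) :
    size u = size v -> u`_0 != 0 ->
    (forall i, (i.+1 < size u)%N -> u`_i.+1 = 0 -> u`_i * u`_i.+2 < 0) ->
    (forall i, (i < size v)%N -> v`_i != 0) ->
    (forall i, u`_i != 0 -> Num.sg v`_i = Num.sg u`_i) ->
  changes (nonzeros u) = changes v.
Proof.
have sg_lt0 (a b c d : R) : Num.sg a = Num.sg c -> Num.sg b = Num.sg d ->
    (a * b < 0) = (c * d < 0).
  by move=> ac bd; rewrite -sgr_lt0 sgrM ac bd -sgrM sgr_lt0.
have [m] := ubnP (size u); elim: m u v => // m IHm.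
case=> [|a [|b u]] [|va [|vb v]] //; rewrite ltnS => um.
- by move=> _ /= -> _ _ _ /=; rewrite !mulr0 !ltxx.
- move=> suv /= a0 uz vnz sguv; rewrite /nonzeros /= a0.
  case: (eqVneq b 0) (uz 0%N isT) => [b0 /(_ b0)|b0 _]; last first.
    have suv' : size (b :: u) = size (vb :: v) by case: suv => /= ->.
    have := IHm (b :: u) (vb :: v) um suv' b0 (fun i => uz i.+1)
              (fun i => vnz i.+1) (fun i => sguv i.+1).
    rewrite /nonzeros /= b0 /= => ->; congr (nat_of_bool _ + _)%N.
    by apply: sg_lt0; apply/esym; [apply: (sguv 0%N)|apply: (sguv 1%N)].
  case: u v => [|c u] [|vc v] //= in um suv uz vnz sguv *.
    by rewrite mulr0 ltxx.
  move=> ac_lt0; have c0 : c != 0.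
    by apply: contraTneq ac_lt0 => ->; rewrite mulr0 ltxx.
  have suv' : size (c :: u) = size (vc :: v) by case: suv => /= ->.
  have := IHm (c :: u) (vc :: v) (ltnW um) suv' c0 (fun i => uz i.+2)
            (fun i => vnz i.+2) (fun i => sguv i.+2).
  rewrite /nonzeros /= c0 /= ac_lt0 => ->; rewrite [RHS]addnA; congr (_ + _)%N.
  have : va * vc < 0.
    by rewrite (sg_lt0 _ _ a c) //; [apply: (sguv 0%N)|apply: (sguv 2%N)].
  have /= vb0 := vnz 1%N isT => vac_lt0.
  have : (va * vb) * (vb * vc) < 0.
    by rewrite -mulrA [vb * _]mulrA mulrCA pmulr_rlt0 // -expr2 exprn_even_gt0.
  by case: (ltrgt0P (va * vb)) => [ab|ab|->]; rewrite ?mul0r ?ltxx //;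
    rewrite ?(pmulr_rlt0 _ ab) ?(nmulr_rlt0 _ ab) => bc; rewrite ?bc // lt_gtF.
Qed.

(** * Sturm's theorem *)

Lemma cindex_modp (R : rcfType) (a b : R) (p q : {poly R}) :
  cindex a b (p %% q) q = cindex a b p q.
Proof.
have [->|q0] := eqVneq q 0; first by rewrite modp0.
rewrite (cindex_mod _ _ p q) modpE cindex_mulCp.
rewrite -sgzX; congr (_ * _).
by apply: (mulrIz (oner_neq0 R)); rewrite -!sgrEz sgrV.
Qed.

(** Sturm's theorem for a generic interval and two arbitrary starting terms,
    with the Cauchy index of q/p in place of a number of roots. A step of the
    Euclidean algorithm turns q/p into -(p mod q)/q; by the inversion formula
    the sum of the Cauchy indices of q/p and p/q only depends on the signs of
    p q at the two ends. *)
Lemma sturm_from_cindex (R : realType) (a b : R) (fuel : nat) (p q : {poly R}) :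
    a < b -> p != 0 -> (size q <= fuel)%N ->
    (forall f, f \in sturm_from fuel p q -> f.[a] != 0 /\ f.[b] != 0) ->
  (changes [seq f.[a] | f <- sturm_from fuel p q])%:Z
    - (changes [seq f.[b] | f <- sturm_from fuel p q])%:Z = cindex a b q p.
Proof.
move=> ltab; elim: fuel p q => [|fuel IHf] p q p0 szq /= nz.
  move: szq; rewrite leqn0 size_poly_eq0 => /eqP ->.
  by rewrite !mulr0 !ltxx cindex0p.
case: (eqVneq q 0) szq nz => [-> _ _|q0 szq nz] /=.
  by rewrite !mulr0 !ltxx cindex0p.
have szr : (size (- (p %% q))%R <= fuel)%N.
  by rewrite size_polyN -ltnS (leq_trans _ szq) // ltn_modp.
have nz' f : f \in sturm_from fuel q (- (p %% q)) -> f.[a] != 0 /\ f.[b] != 0.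
  by move=> fs; apply: nz; rewrite inE fs orbT.
have [pa pb] := nz p (mem_head _ _).
have [qa qb] : q.[a] != 0 /\ q.[b] != 0.
  by apply: nz'; case: (fuel) => [|?] /=; rewrite mem_head.
have /(canRL (addrK _)) -> :
    cindex a b q p + cindex a b p q = cross (p * q) a b.
  by apply: cindex_inv => //; rewrite rootM !rootE negb_or; apply/andP.
rewrite -[cindex a b p q]cindex_modp.
have -> : - cindex a b (p %% q) q = cindex a b (- (p %% q)) q.
  by rewrite -scaleN1r cindex_mulCp sgzN sgz1 mulN1r.
rewrite -(IHf q) // !PoszD opprD addrACA; congr (_ + _).
have hE x : head 0 [seq f.[x] | f <- sturm_from fuel q (- (p %% q))] = q.[x].
  by case: (fuel).
rewrite !hE /cross /variation !hornerM.
have := mulf_neq0 pa qa; have := mulf_neq0 pb qb.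
move: (p.[a] * q.[a]) (p.[b] * q.[b]) => u v.
case: (ltrgt0P v) => [v0|v0|->]; rewrite ?eqxx // => _.
  by rewrite (gtr0_sgz v0) mul1r (pmulr_llt0 _ v0) subr0.
rewrite (ltr0_sgz v0) (nmulr_llt0 _ v0).
by case: (ltrgt0P u) => // ->; rewrite eqxx.
Qed.

(** Write f = g (X - x)^k with g(x) != 0: by continuity g keeps its sign near x,
    and (X - x)^k vanishes at x only. *)
Lemma sign_stable_near (R : rcfType) (s : seq {poly R}) (x : R) :
    all (fun f => f != 0) s ->
  exists2 d, 0 < d & forall y, y != x -> `|y - x| < d -> forall f, f \in s ->
    f.[y] != 0 /\ (f.[x] != 0 -> Num.sg f.[y] = Num.sg f.[x]).
Proof.
elim: s => [_|f s IHs /= /andP[f0 /IHs[d d0 dP]]]; first by exists 1.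
have [k [g gx fE]] := multiplicity_XsubC f x; rewrite f0 /= rootE in gx.
have g0 : 0 < `|g.[x]| by rewrite normr_gt0.
have [e e0 eP] := poly_cont x g g0.
exists (Num.min d e) => [|y yx]; first by rewrite lt_min d0.
rewrite lt_min => /andP[yd ye] h; rewrite inE.
case/predU1P=> [-> {h}|]; last exact: dP.
have sg_g : Num.sg g.[y] = Num.sg g.[x].
  have := eP y ye; move: (g.[y]) (g.[x]) gx => u v {}gx.
  have [v0|v0|/eqP] := ltgtP v 0; last by rewrite (negPf gx).
    rewrite (ltr0_norm v0) => /(le_lt_trans (ler_norm _)).
    by rewrite ltrBlDr addNr => u0; rewrite !ltr0_sg.
  rewrite (gtr0_norm v0) distrC => /(le_lt_trans (ler_norm _)).
  by rewrite ltrBlDr ltrDl => u0; rewrite !gtr0_sg.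
have gy : g.[y] != 0 by rewrite -sgr_eq0 sg_g sgr_eq0.
split.
  by rewrite fE hornerM horner_exp hornerXsubC mulf_neq0 ?expf_neq0 ?subr_eq0.
rewrite fE !hornerM !horner_exp !hornerXsubC subrr.
by case: (k) => [|k']; rewrite ?expr0 ?mulr1 // exprS mul0r mulr0 eqxx.
Qed.

(** Two consecutive terms cannot vanish together at x: the recurrence would
    propagate the zero back to p. Where S_(i+1) vanishes, the recurrence reads
    S_i = - S_(i+2). *)
Lemma sturm_isolated_zeros (R : realType) (p : {poly R}) (x : R) :
    p.[x] != 0 ->
  forall i, (i.+1 < size (sturm p))%N ->
    ((sturm p)`_i.+1).[x] = 0 -> ((sturm p)`_i).[x] * ((sturm p)`_i.+2).[x] < 0.
Proof.
move=> px; have p0 : p != 0 by apply: contraNneq px => ->; rewrite horner0.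
have [s0 _ sE _] := sturmP p0; set s := sturm p in s0 sE *.
have recE i : (i.+1 < size s)%N ->
    (s`_i).[x] = (s`_i %/ s`_i.+1).[x] * (s`_i.+1).[x] - (s`_i.+2).[x].
  move=> lti; rewrite sE // {1}(divp_eq s`_i s`_i.+1) hornerD hornerM.
  by rewrite hornerN opprK.
have nz i : (i.+1 < size s)%N -> (s`_i.+1).[x] = 0 -> (s`_i).[x] != 0.
  elim: i => [|i IHi] lti si0; first by rewrite s0.
  apply/eqP => si; have := IHi (ltnW lti) si.
  by rewrite recE ?(ltnW lti) // si si0 mulr0 subrr eqxx.
move=> i lti si0; have := recE i lti; rewrite si0 mulr0 sub0r => siE.
have := nz i lti si0; rewrite siE oppr_eq0 mulNr oppr_lt0 => ?.
by rewrite -expr2 exprn_even_gt0 ?orbT.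
Qed.

(** V at x is computed at a nearby point y where no term of the sequence
    vanishes. *)
Lemma sign_changes_near (R : realType) (p : {poly R}) (x y : R) :
    p.[x] != 0 ->
    (forall f, f \in sturm p ->
      f.[y] != 0 /\ (f.[x] != 0 -> Num.sg f.[y] = Num.sg f.[x])) ->
  sign_changes (sturm p) x = changes [seq f.[y] | f <- sturm p].
Proof.
move=> px stable; rewrite sign_changesE.
have p0 : p != 0 by apply: contraNneq px => ->; rewrite horner0.
have evE z i : [seq f.[z] | f <- sturm p]`_i = ((sturm p)`_i).[z].
  have [lti|lei] := ltnP i (size (sturm p)); first by rewrite (nth_map 0).
  by rewrite !nth_default ?size_map ?horner0.
apply: changes_isolated_zeros; rewrite ?size_map //.
- by rewrite evE; have [-> _ _ _] := sturmP p0.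
- by move=> i lti; rewrite !evE; apply: sturm_isolated_zeros.
- by move=> i lti; rewrite evE; case: (stable _ (mem_nth 0 lti)).
move=> i; rewrite !evE.
have [lti|lei] := ltnP i (size (sturm p)).
  by case: (stable _ (mem_nth 0 lti)).
by rewrite nth_default // !horner0.
Qed.

(** After moving the ends to generic points the difference is the Cauchy index
    of p'/p, in which every distinct root of p counts for 1. *)
Lemma sturm_theorem (R : realType) (p : {poly R}) (a b : R) :
    a < b -> p.[a] != 0 -> p.[b] != 0 ->
  (sign_changes (sturm p) a)%:Z - (sign_changes (sturm p) b)%:Z
    = (size (roots p a b))%:Z.
Proof.
move=> ltab pa pb.
have p0 : p != 0 by apply: contraNneq pa => ->; rewrite horner0.
have ps : p \in sturm p by rewrite /sturm; case: size => [|k]; rewrite mem_head.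
have [_ _ _ snz] := sturmP p0.
have [d d0 dP] := sign_stable_near a snz.
have [e e0 eP] := sign_stable_near b snz.
(* Both ends are moved outwards, within the neighbourhoods where no term of the
   sequence acquires a zero; in particular no root of p is gained. *)
pose a' := a - d / 2; pose b' := b + e / 2.
have lta : a' < a by rewrite ltrBlDr ltrDl divr_gt0.
have ltb : b < b' by rewrite ltrDl divr_gt0.
have near_a y : a' <= y < a -> y != a /\ `|y - a| < d.
  move=> /andP[y1 y2]; split; first by rewrite lt_eqF.
  rewrite ltr_norml; apply/andP; split; last first.
    by rewrite (lt_trans _ d0) // subr_lt0.
  rewrite ltrBrDl (lt_le_trans _ y1) // ltrD2l ltrN2.
  by rewrite ltr_pdivrMr // ltr_pMr // ltr1n.
have near_b y : b < y <= b' -> y != b /\ `|y - b| < e.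
  move=> /andP[y1 y2]; split; first by rewrite gt_eqF.
  rewrite ltr_norml; apply/andP; split.
    by rewrite (@lt_trans _ _ 0) ?oppr_lt0 // subr_gt0.
  rewrite ltrBlDl (le_lt_trans y2) // ltrD2l.
  by rewrite ltr_pdivrMr // ltr_pMr // ltr1n.
have [a'a a'd] : a' != a /\ `|a' - a| < d by apply: near_a; rewrite lexx.
have [b'b b'e] : b' != b /\ `|b' - b| < e by apply: near_b; rewrite lexx ltb.
rewrite (@sign_changes_near _ p a a') ?(@sign_changes_near _ p b b') //;
  [|by move=> f; apply: eP|by move=> f; apply: dP].
have lta'b' : a' < b' by rewrite (lt_trans lta) // (lt_trans ltab).
rewrite (sturm_from_cindex lta'b') //; first last.
- move=> f fs; split; first by case: (dP _ a'a a'd f fs).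
  by case: (eP _ b'b b'e f fs).
- exact/ltnW/lt_size_deriv.
rewrite -[p^`()]mulr1 -taq_cindex /taq.
under eq_bigr do rewrite hornerC sgz1.
rewrite big_const_seq count_predT iter_addr_0 natz; congr Posz.
apply/perm_size/uniq_perm; rewrite ?uniq_roots // => x.
rewrite !in_roots p0 !andbT; apply: andb_id2l => /eqP px.
rewrite !in_itv /=; apply/andP/andP => -[ax xb]; last first.
  by rewrite (lt_trans lta) // (lt_trans xb).
split; rewrite ltNge le_eqVlt; apply/negP => /predU1P[xE|ltx].
- by rewrite -xE px eqxx in pa.
- have [xa xd] : x != a /\ `|x - a| < d by apply: near_a; rewrite ltW.
  by have [] := dP _ xa xd p ps; rewrite px eqxx.
- by rewrite xE px eqxx in pb.
have [xa xd] : x != b /\ `|x - b| < e by apply: near_b; rewrite ltx ltW.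
by have [] := eP _ xa xd p ps; rewrite px eqxx.
Qed.

(** * A bound on the roots *)

Lemma root_bound_ge1 (R : realType) (p : {poly R}) : 1 <= root_bound p.
Proof.
rewrite lerDl; elim/big_rec: _ => // i a _ a0.
by rewrite le_max normr_ge0.
Qed.

(** Cauchy's bound. With m the largest |p_i|, i < r, and |x| >= 1 + m, a root x
    would give |x|^r <= m (1 + |x| + ... + |x|^(r-1)), which is at most
    (|x| - 1) (1 + |x| + ... + |x|^(r-1)) = |x|^r - 1. *)
Lemma lt_root_bound (R : realType) (p : {poly R}) (x : R) :
  p \is monic -> root p x -> `|x| < root_bound p.
Proof.
move=> p_monic px; rewrite ltNge; apply/negP => le_x.
set r := (size p).-1; pose m := root_bound p - 1.
have mP (i : 'I_r) : `|p`_i| <= m.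
  by rewrite /m addrC addKr (le_bigmax_cond _ (fun i : 'I_r => `|p`_i|)).
have le_m : m <= `|x| - 1 by rewrite lerD2r.
have sz_p : size p = r.+1 by rewrite prednK // size_poly_gt0 monic_neq0.
have : `|x| ^+ r <= `|x| ^+ r - 1.
  have xrE : `|x| ^+ r = `|\sum_(i < r) p`_i * x ^+ i|.
    have := rootP px; rewrite horner_coef sz_p big_ord_recr /=.
    rewrite -[p`_r]/(lead_coef p) (monicP p_monic) mul1r => /eqP.
    by rewrite addr_eq0 => /eqP ->; rewrite normrN normrX.
  rewrite [X in X <= _]xrE (le_trans (ler_norm_sum _ _ _)) //.
  rewrite subrX1 mulr_sumr; apply: ler_sum => i _.
  by rewrite normrM normrX ler_wpM2r ?exprn_ge0 // (le_trans (mP i)).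
by rewrite lerDl oppr_ge0 ler10.
Qed.

(** * Squarefree part in characteristic 0 *)

(** Repeatedly dividing p by its gcd with q ends with a divisor h of p that is
    coprime to q; the factors removed all divide q. *)
Lemma coprime_part (F : fieldType) (p q : {poly F}) : p != 0 ->
  exists h k, [/\ h %| p, coprimep h q & p %| h * q ^+ k].
Proof.
have [m] := ubnP (size p); elim: m p => // m IHm p; rewrite ltnS => szp p0.
have [cpq|ncpq] := boolP (coprimep p q).
  by exists p, 0%N; rewrite dvdpp mulr1.
have g0 : gcdp p q != 0 by rewrite gcdp_eq0 negb_and p0.
have gE := divpK (dvdp_gcdl p q); set g := gcdp p q in g0 gE.
have p10 : p %/ g != 0 by apply: contraNneq p0 => e; rewrite -gE e mul0r.
have g1 : (1 < size g)%N.
  by rewrite ltn_neqAle eq_sym size_poly_gt0 g0 andbT; exact: ncpq.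
have [|h [k [hp hq pd]]] := IHm (p %/ g) _ p10.
  rewrite (leq_trans _ szp) // -[in X in (_ < X)%N]gE size_mul //.
  by case: (size g) g1 => [|[|s]] // _; rewrite !addnS /= ltnS leq_addr.
exists h, k.+1; split=> //.
  by rewrite (dvdp_trans hp) // divp_dvd // dvdp_gcdl.
by rewrite -gE exprSr mulrA dvdp_mul // dvdp_gcdr.
Qed.

(** In characteristic 0, p / gcd(p, p') retains all the irreducible factors of
    p. Indeed, let h be the part of p that is coprime to q = p / gcd(p, p'):
    it divides gcd(p, p'), hence p', and as p = u h with u coprime to h, it
    divides h', which forces h to be constant. *)
Lemma dvdp_expr_squarefree_part (F : realFieldType) (p : {poly F}) : p != 0 ->
  exists k, p %| (p %/ gcdp p p^`()) ^+ k.
Proof.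
move=> p0; set g := gcdp p p^`(); set q := p %/ g.
have gE : q * g = p by apply/divpK/dvdp_gcdl.
have [h [k [hp hq pd]]] := coprime_part q p0.
have hg : h %| g by rewrite -(Gauss_dvdpr _ hq) gE.
have uE := divpK hp; set u := p %/ h in uE.
have h0 : h != 0 by apply: contraNneq p0 => e; rewrite -uE e mulr0.
have uq : u %| q ^+ k by rewrite -(dvdp_mul2r _ _ h0) uE mulrC.
have hu : coprimep h u := coprimep_dvdl uq (coprimep_expr k hq).
have hp' : h %| p^`() by rewrite (dvdp_trans hg) // dvdp_gcdr.
have hh' : h %| h^`().
  move: hp'; rewrite -uE derivM (dvdp_addr _ (dvdp_mull _ (dvdpp h))).
  by rewrite Gauss_dvdpr.
have h1 : size h == 1%N.
  rewrite eqn_leq size_poly_gt0 h0 andbT leqNgt; apply/negP => h1.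
  have h'0 : h^`() != 0.
    by rewrite -size_poly_eq0 size_deriv -subn1 subn_eq0 -ltnNge.
  by have := dvdp_leq h'0 hh'; rewrite leqNgt lt_size_deriv.
exists k; rewrite (dvdp_trans pd) // -[X in _ %| X]mul1r dvdp_mul //.
by rewrite (eqp_dvdl _ (_ : h %= 1)) ?dvdpp // -size_poly_eq1.
Qed.

(** * Polynomials in commuting matrices and semi-simplicity *)

(** The minimal polynomial has all the irreducible factors of the characteristic
    one. If p(A) = 0 then, over the ring of polynomials, p I is a multiple of
    X I - A; take determinants. *)
Lemma char_poly_dvd_expr (F : fieldType) (n' : nat) (A : 'M[F]_n'.+1)
    (p : {poly F}) :
  horner_mx A p = 0 -> char_poly A %| p ^+ n'.+1.
Proof.
move=> pA; have [phi [[psi phiK psiK] phiZ phiC _]] := mx_poly_ring_isom F n'.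
have /rootP/factor_theorem[q qE] : (map_poly scalar_mx p).[A] = 0 by [].
have : psi q * char_poly_mx A = p%:M.
  apply: (can_inj phiK); rewrite rmorphM /= psiK phiZ qE rmorphB /= phiC phiZ.
  by rewrite map_polyX.
move/(congr1 determinant); rewrite det_mulmx det_scalar => <-.
exact: dvdp_mull.
Qed.

(** Taylor expansion: q(A + N) = q(A) + N C with C commuting with N (and
    with A, for the induction on q). Applied to q = p^j it gives
    p(A + N)^j = N C. *)
Lemma horner_mx_nilpotentD (F : fieldType) (n' : nat) (A N : 'M[F]_n'.+1)
    (p : {poly F}) (j k : nat) :
    A * N = N * A -> N ^+ k = 0 -> horner_mx A p ^+ j = 0 ->
  exists m, horner_mx (A + N) p ^+ m = 0.
Proof.
move=> cAN Nk pAj.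
have taylor (q : {poly F}) : exists C,
    [/\ horner_mx (A + N) q = horner_mx A q + N * C,
        GRing.comm C N & GRing.comm C A].
  elim/poly_ind: q => [|q c [C [qE cCN cCA]]].
    exists 0; split; rewrite ?rmorph0 ?mulr0 ?addr0 //;
      exact/commr_sym/commr0.
  have cqN : GRing.comm (horner_mx A q) N.
    exact/commr_sym/comm_mx_horner/commr_sym.
  have cqA : GRing.comm (horner_mx A q) A.
    exact/commr_sym/comm_mx_horner.
  exists (C * (A + N) + horner_mx A q); split.
  - rewrite !rmorphD !rmorphM /= !horner_mx_X !horner_mx_C qE.
    rewrite mulrDl [horner_mx A q * (_ + _)]mulrDr cqN [N * (_ + _)]mulrDr.
    rewrite mulrA -addrA.
    by rewrite [_ + c%:M]addrC addrACA [N * _ + _]addrC.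
  - apply: commr_sym; apply: commrD; last exact: commr_sym.
    apply: commrM; first exact: commr_sym.
    by apply: commrD => //; apply: commr_sym.
  - apply: commr_sym; apply: commrD; last exact: commr_sym.
    apply: commrM; first exact: commr_sym.
    exact: commrD.
have [C [qE cCN _]] := taylor (p ^+ j).
exists (j * k)%N; rewrite exprM -rmorphXn /= qE rmorphXn /= pAj add0r.
by rewrite exprMn_comm ?Nk ?mul0r.
Qed.

(** On a stable complement W of the kernel of T = p(S), the map T is injective
    and nilpotent, so W = 0 and T = 0. *)
Lemma semisimple_horner_nilpotent (R : realType) (n' : nat) (S : 'M[R]_n'.+1)
    (p : {poly R}) (k : nat) :
  semisimple_mx S -> horner_mx S p ^+ k = 0 -> horner_mx S p = 0.
Proof.
move=> ssS; set T := horner_mx S p => Tk.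
pose f := linfun (mulmx T : 'cV[R]_n'.+1 -> 'cV[R]_n'.+1).
have fE v : f v = T *m v by rewrite lfunE.
have cTS : S *m T = T *m S by apply: comm_mx_horner.
have stU : stable_subspace S (lker f).
  move=> v; rewrite !memv_ker !fE => /eqP Tv.
  by rewrite mulmxA -cTS -mulmxA Tv mulmx0.
have [W [stW sumW capW]] := ssS _ stU.
have stT v : v \in W -> T *m v \in W.
  move=> vW; rewrite /T; elim/poly_ind: (p) => [|q c IHq].
    by rewrite rmorph0 mul0mx mem0v.
  rewrite rmorphD rmorphM /= horner_mx_X horner_mx_C mulmxDl mul_scalar_mx.
  rewrite memvD ?memvZ // -mulmxE.
  have -> : horner_mx S q *m S = S *m horner_mx S q.
    by apply/esym; apply: comm_mx_horner.
  by rewrite -mulmxA; apply: stW.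
have stTj j v : v \in W -> T ^+ j *m v \in W.
  by elim: j => [|j IHj] vW; rewrite ?mul1mx // exprS -mulmxE -mulmxA stT ?IHj.
have W0 v : v \in W -> v = 0.
  move=> vW; have : T ^+ k *m v = 0 by rewrite Tk mul0mx.
  elim: (k) => [|j IHj]; first by rewrite mul1mx.
  rewrite exprS -mulmxE -mulmxA => Tv; apply: IHj; apply/eqP.
  by rewrite -memv0 -capW memv_cap stTj // memv_ker fE Tv eqxx.
have Uf v : v \in lker f.
  have : v \in (lker f + W)%VS by rewrite sumW memvf.
  by case/memv_addP => u uU [w /W0 -> ->]; rewrite addr0.
apply/matrixP => i j; rewrite mxE.
have := Uf (delta_mx j 0); rewrite memv_ker fE => /eqP /matrixP /(_ i 0).
by rewrite -colE !mxE.
Qed.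

(** * The reduced characteristic polynomial *)

Lemma charpolyE (R : realType) (n : nat) (A : 'M[R]_n) :
  charpoly A = (-1) ^+ n *: char_poly A.
Proof.
rewrite /charpoly /char_poly /char_poly_mx -opprB -scaleN1r detZ.
by rewrite -mul_polyC rmorphXn /= polyCN polyC1.
Qed.

Lemma monic_normalization_monic (R : realType) (p : {poly R}) :
  p != 0 -> monic_normalization p \is monic.
Proof. by move=> p0; rewrite monicE lead_coefZ mulVf ?lead_coef_eq0. Qed.

Lemma monic_normalization_eqp (R : realType) (p : {poly R}) :
  p != 0 -> monic_normalization p %= p.
Proof. by move=> p0; rewrite eqp_scale // invr_eq0 lead_coef_eq0. Qed.

Lemma reduced_charpolyP (R : realType) (n : nat) (A : 'M[R]_n)
    (P := reduced_charpoly A) :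
  [/\ P \is monic, separable_poly P, P %| char_poly A
    & exists k, char_poly A %| P ^+ k].
Proof.
have chiE : charpoly A %= char_poly A.
  by rewrite charpolyE eqp_scale // signr_eq0.
have chi0 : charpoly A != 0.
  by rewrite charpolyE scaler_eq0 signr_eq0 monic_neq0 // char_poly_monic.
set chi := charpoly A in chiE chi0; pose q := chi %/ gcdp chi chi^`().
have qE : q * gcdp chi chi^`() = chi by apply/divpK/dvdp_gcdl.
have q0 : q != 0 by apply: contraNneq chi0 => q0; rewrite -qE q0 mul0r.
have Pq : P %= q by apply: monic_normalization_eqp.
split; first exact: monic_normalization_monic.
- by rewrite (eqp_separable Pq) make_separable.
- by rewrite (eqp_dvdl _ Pq) -(eqp_dvdr _ chiE) -qE dvdp_mulr.
have [k chi_q] := dvdp_expr_squarefree_part chi0; exists k.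
by rewrite -(eqp_dvdl _ chiE) (eqp_dvdr _ (eqp_exp k Pq)).
Qed.

(** All the real roots of p lie in ]-M, M[. *)
Lemma size_roots_split (R : realType) (p : {poly R}) (M := root_bound p) :
    p \is monic ->
  size (roots p (- M) M) = (size p).-1 <->
    exists2 rs, uniq rs & p = \prod_(x <- rs) ('X - x%:P).
Proof.
move=> p_monic; have p0 := monic_neq0 p_monic.
have sz_p : size p = (size p).-1.+1 by rewrite prednK // size_poly_gt0.
split=> [sz|[rs rsU pE]].
  exists (roots p (- M) M); first exact: uniq_roots.
  rewrite [LHS](@all_roots_prod_XsubC _ p (roots p (- M) M)).
  - by rewrite (monicP p_monic) scale1r.
  - by rewrite sz.
  - by apply/allP => x; rewrite in_roots => /and3P[].
  - by rewrite uniq_rootsE uniq_roots.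
have -> : (size p).-1 = size rs by rewrite pE size_prod_XsubC.
apply/perm_size/uniq_perm; rewrite ?uniq_roots // => x.
rewrite in_roots p0 andbT -root_prod_XsubC -pE.
apply: andb_idr => px; rewrite in_itv /= -ltr_norml.
exact: lt_root_bound.
Qed.

Lemma expr_prod_XsubC (R : comNzRingType) (rs : seq R) (k : nat) :
  (\prod_(x <- rs) ('X - x%:P)) ^+ k
    = \prod_(x <- flatten (nseq k rs)) ('X - x%:P).
Proof.
by elim: k => [|k IHk]; rewrite ?big_nil // exprS IHk /= big_cat.
Qed.

Lemma separable_split (R : fieldType) (p : {poly R}) (rs : seq R) (k : nat) :
    p \is monic -> separable_poly p ->
    p %| (\prod_(x <- rs) ('X - x%:P)) ^+ k ->
  exists2 s, uniq s & p = \prod_(x <- s) ('X - x%:P).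
Proof.
move=> p_monic p_sep; rewrite expr_prod_XsubC => /dvdp_prod_XsubC[m pE].
exists (mask m (flatten (nseq k rs))).
  by rewrite -separable_prod_XsubC -(eqp_separable pE).
by apply/eqP; rewrite -eqp_monic // monic_prod_XsubC.
Qed.

(** * Diagonalizability of the semi-simple part *)

Theorem mainTheorem3 (R : realType) (n : nat) (n_ge1 : (1 <= n)%N)
    (A S N : 'M[R]_n) (dunfordA : dunford_decomposition A S N) :
  let P := reduced_charpoly A in
  let r := (size P).-1 in
  let M := root_bound P in
  let V := sign_changes (sturm P) in
  (V (- M))%:Z - (V M)%:Z = r%:Z <-> diagonalizable S.
Proof.
case: n n_ge1 A S N dunfordA => // n' _ A S N [AE SN [j Nj] ssS] P r M V.
have [P_monic P_sep P_chi [k chi_P]] := reduced_charpolyP A.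
have M_gt0 : 0 < M by rewrite (lt_le_trans ltr01) ?root_bound_ge1.
have noroot_M x : `|x| = M -> P.[x] != 0.
  move=> xM; apply/negP => Px; have := lt_root_bound P_monic Px.
  by rewrite xM ltxx.
have PM : P.[M] != 0 by apply: noroot_M; rewrite gtr0_norm.
have PNM : P.[- M] != 0 by apply: noroot_M; rewrite normrN gtr0_norm.
have cSN : S * N = N * S := SN.
have SE : S = A + - N by rewrite AE addrK.
have cAN : A * - N = - N * A.
  by rewrite AE mulrN mulNr mulrDl mulrDr cSN.
have NNj : (- N) ^+ j = 0 by rewrite exprNn Nj mulr0.
rewrite /V (sturm_theorem _ PNM PM) ?gtrN //.
have -> : ((size (roots P (- M) M))%:Z = r%:Z) <-> (size (roots P (- M) M) = r).
  by split=> [[]|->].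
rewrite (size_roots_split P_monic) diagonalizableP.
split=> [[rs rsU PE]|[rs rsU]].
  exists rs; rewrite // -PE; apply/mxminpoly_minP.
  have PkA : horner_mx A P ^+ k = 0.
    rewrite -rmorphXn; apply/mxminpoly_minP.
    exact: dvdp_trans (mxminpoly_dvd_char A) chi_P.
  have [m PmS] := horner_mx_nilpotentD cAN NNj PkA.
  by rewrite -SE in PmS; apply: semisimple_horner_nilpotent PmS.
move/mxminpoly_minP; set q := \prod_(x <- rs) _ => qS.
have [m qmA] := horner_mx_nilpotentD cSN Nj (qS : horner_mx S q ^+ 1 = 0).
rewrite -AE -rmorphXn in qmA.
apply: (separable_split P_monic P_sep (rs := rs) (k := (m * n'.+1)%N)).
by rewrite exprM (dvdp_trans P_chi) ?char_poly_dvd_expr.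
Qed.
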